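(* Let $(V,E)$ be a connected graph, and let $\mathcal{M}^I\subseteq V$, $\mathcal{M}^L\subseteq E$, $\mathcal{M}^P\subseteq V$. The perfect protection problem is described by the integer program (IP) defined in the context: both have the same objective function, depending on $(x,y,z)$ only, and for binary vectors $x\in\{0,1\}^V$, $y\in\{0,1\}^E$, $z\in\{0,1\}^V$ with $x_i=0$ for $i\notin\mathcal{M}^I$, $y_j=0$ for $j\notin\mathcal{M}^L$, $z_k=0$ for $k\notin\mathcal{M}^P$, the triple $(x,y,z)$ satisfies the perfect protection constraint if and only if there exist $w,f,u$ such that $(x,y,z,w,f,u)$ is feasible for (IP).
   Context: Graphs are finite and undirected; edges are unordered pairs of two nodes. Let $0$ be an additional node not in $V$. Costs $c^I_i$ ($i\in\mathcal{M}^I$), $c^L_j$ ($j\in\mathcal{M}^L$), $c^P_k$ ($k\in\mathcal{M}^P$) are given real numbers. Perfect protection problem: over binary $x\in\{0,1\}^V$, $y\in\{0,1\}^E$, $z\in\{0,1\}^V$ with $x_i=0$ for $i\notin\mathcal{M}^I$, $y_j=0$ for $j\notin\mathcal{M}^L$, $z_k=0$ for $k\notin\mathcal{M}^P$, minimize $\sum_{i\in\mathcal{M}^I}c^I_ix_i+\sum_{j\in\mathcal{M}^L}c^L_jy_j+\sum_{k\in\mathcal{M}^P}c^P_kz_k$ subject to the perfect protection constraint: there exists $g:I(x)\to E$ with $i\in g(i)$ for all $i\in I(x)$ such that the graph $(V\cup\{0\},\,L(y)\cup E_{P0}(z)\cup g(I(x)))$ is connected. Here $I(x)=\{i\in V\mid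 x_i=1\}$, $L(y)=\{e\in E\mid y_e=1\}$, $P(z)=\{i\in V\mid z_i=1\text{ or there is }k\in V\text{ with }z_k=1,\ \{i,k\}\in E\}$, $E_{P0}(z)=\{\{i,0\}\mid i\in P(z)\}$, and $g(I(x))=\{g(i)\mid i\in I(x)\}$. Integer program (IP): put $\bar V=V\cup\{0\}$, $\bar E=E\cup\{\{i,0\}\mid i\in V\}$, $\bar{\mathcal{A}}=\{(i,j),(j,i)\mid\{i,j\}\in\bar E\}$. Variables: $x\in\{0,1\}^V$ with $x_i=0$ for $i\notin\mathcal{M}^I$, $y\in\{0,1\}^E$ with $y_j=0$ for $j\notin\mathcal{M}^L$, $z\in\{0,1\}^V$ with $z_k=0$ for $k\notin\mathcal{M}^P$, $w_{ei}\in\{0,1\}$ for $(e,i)\in E\times V$, $f_{ij}\in\{0,1\}$ for $(i,j)\in\bar{\mathcal{A}}$, and $u_i\in\{0,1,\ldots,|V|\}$ for $i\in\bar V$. Minimize the same objective subject to: 1. $(|\bar V|-1)f_{ij}+(|\bar V|-3)f_{ji}+u_i-u_j\le|\bar V|-2$ for all $(i,j)\in\bar{\mathcal{A}}$; 2. $0\le u_i\le|\bar V|-1$ for all $i\in\bar V$; 3. $\sum_{j:(i,j)\in\bar{\mathcal{A}}}f_{ij}=1$ for all $i\in\bar V\setminus\{0\}$; 4. $\sum_{j:(j,0)\in\bar{\mathcal{A}}}f_{j0}\ge1$; 5. $\sum_{(i,j)\in\bar{\mathcal{A}}}f_{ij}=|\bar V|-1$; 6. $f_{0i}+f_{i0}\le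 z_i+\sum_{j:\{i,j\}\in E}z_j$ for all $i\in V$; 7. $f_{ij}+f_{ji}\le y_{\{i,j\}}+w_{\{i,j\}i}+w_{\{i,j\}j}$ for all $\{i,j\}\in E$; 8. $w_{ei}=0$ whenever $i\notin e$, and $\sum_{e\in E}w_{ei}\le x_i$ for all $i\in V$.
   Formalization: It is additionally assumed that every node of M^I is incident with an edge of E; this is automatic for connected graphs with at least two nodes and excludes only the one-node graph with M^I = V, where the claim can fail (M^P = V, x = z = 1). Connected graphs are taken to be non-empty. *)

(* Defs.v *)
From mathcomp Require Import all_boot all_order all_algebra.
From mathcomp Require Import reals.

Set Implicit Arguments.
Unset Strict Implicit.
Unset Printing Implicit Defensive.

Import Order.TTheory GRing.Theory Num.Theory.

(* A graph with node set T is given by its edge set F : {set {set T}}, whose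
   members are unordered pairs of distinct nodes. *)
Definition is_edge_set (T : finType) (F : {set {set T}}) : Prop :=
  forall e, e \in F -> #|e| = 2.

(* A connected graph has at least one node. *)
Definition connected_graph (T : finType) (F : {set {set T}}) : Prop :=
  0 < #|T| /\ forall a b : T, connect (fun u v => [set u; v] \in F) a b.

(* Vbar = V u {0} is option V, where None is the additional node 0. *)

Definition lift_edges (V : finType) (F : {set {set V}})
  : {set {set option V}} := [set Some @: e | e : {set V} in F].

(* A vector of {0,1}^E is represented by a function on all of {set V}; every
   condition and sum below only reads its entries at elements of E, except that
   the support condition on y makes it vanish outside of ML, a subset of E. *)
Definition admissible (V : finType)
    (MI : {set V}) (ML : {set {set V}}) (MP : {set V})
    (x : {ffun V -> bool}) (y : {ffun {set V} -> bool})
    (z : {ffun V -> bool}) : Prop :=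
  [/\ forall i, i \notin MI -> x i = false,
      forall j, j \notin ML -> y j = false
    & forall k, k \notin MP -> z k = false].

(* I(x) *)
Definition injection_nodes (V : finType) (x : {ffun V -> bool}) : {set V} :=
  [set i | x i].

(* L(y) *)
Definition line_edges (V : finType) (E : {set {set V}})
    (y : {ffun {set V} -> bool}) : {set {set V}} :=
  [set e in E | y e].

(* P(z) *)
Definition phasor_nodes (V : finType) (E : {set {set V}})
    (z : {ffun V -> bool}) : {set V} :=
  [set i | z i || [exists k, z k && ([set i; k] \in E)]].

(* E_{P0}(z) *)
Definition phasor_edges (V : finType) (E : {set {set V}})
    (z : {ffun V -> bool}) : {set {set option V}} :=
  [set [set Some i; None] | i in phasor_nodes E z].

(* The map g : I(x) -> E is represented by a total function of which only the
   values on I(x) are constrained or used. If a node of I(x) has no incident edge,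
   which can only happen in a connected graph with a single node, there is no
   such g. *)
Definition perfect_protection (V : finType) (E : {set {set V}})
    (x : {ffun V -> bool}) (y : {ffun {set V} -> bool})
    (z : {ffun V -> bool}) : Prop :=
  exists g : V -> {set V},
    (forall i, i \in injection_nodes x -> g i \in E /\ i \in g i) /\
    connected_graph (lift_edges (line_edges E y) :|: phasor_edges E z
                     :|: lift_edges (g @: injection_nodes x)).

Local Open Scope ring_scope.

Definition ppp_objective (R : realType) (V : finType)
    (MI : {set V}) (ML : {set {set V}}) (MP : {set V})
    (cI : V -> R) (cL : {set V} -> R) (cP : V -> R)
    (x : {ffun V -> bool}) (y : {ffun {set V} -> bool})
    (z : {ffun V -> bool}) : R :=
  \sum_(i in MI) cI i * (x i)%:R + \sum_(j in ML) cL j * (y j)%:R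
  + \sum_(k in MP) cP k * (z k)%:R.

Definition ext_edges (V : finType) (E : {set {set V}})
  : {set {set option V}} :=
  lift_edges E :|: [set [set Some i; None] | i in [set: V]].

Definition ext_arcs (V : finType) (E : {set {set V}})
  : {set option V * option V} :=
  [set a | [set a.1; a.2] \in ext_edges E].

Definition ip_objective (R : realType) (V : finType)
    (MI : {set V}) (ML : {set {set V}}) (MP : {set V})
    (cI : V -> R) (cL : {set V} -> R) (cP : V -> R)
    (x : {ffun V -> bool}) (y : {ffun {set V} -> bool})
    (z : {ffun V -> bool}) (w : {ffun {set V} * V -> bool})
    (f : {ffun option V * option V -> bool})
    (u : {ffun option V -> 'I_#|V|.+1}) : R :=
  \sum_(i in MI) cI i * (x i)%:R + \sum_(j in ML) cL j * (y j)%:R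
  + \sum_(k in MP) cP k * (z k)%:R.

(* The entries of w at (e, i) with e not in E, and those of f at pairs that are
   not arcs, do not occur in any constraint. The order constraint is stated over
   int because |Vbar| - 3 is negative when V has a single node. *)
Record ip_feasible (V : finType) (E : {set {set V}})
    (MI : {set V}) (ML : {set {set V}}) (MP : {set V})
    (x : {ffun V -> bool}) (y : {ffun {set V} -> bool})
    (z : {ffun V -> bool}) (w : {ffun {set V} * V -> bool})
    (f : {ffun option V * option V -> bool})
    (u : {ffun option V -> 'I_#|V|.+1}) : Prop := IpFeasible {
  ip_admissible : admissible MI ML MP x y z;
  ip_order : forall i j : option V, (i, j) \in ext_arcs E ->
    (#|{: option V}|%:Z - 1) * (f (i, j))%:Z
    + (#|{: option V}|%:Z - 3) * (f (j, i))%:Z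
    + (u i)%:Z - (u j)%:Z <= #|{: option V}|%:Z - 2;
  ip_bounds : forall i : option V,
    0 <= (u i)%:Z <= #|{: option V}|%:Z - 1;
  ip_out : forall i : option V, i != None ->
    (\sum_(j | (i, j) \in ext_arcs E) f (i, j) = 1)%N;
  ip_root :
    (1 <= \sum_(j | (j, None) \in ext_arcs E) f (j, None))%N;
  ip_size :
    (\sum_(a in ext_arcs E) f a = #|{: option V}| - 1)%N;
  ip_phasor : forall i : V,
    (f (None, Some i) + f (Some i, None)
     <= z i + \sum_(j | [set i; j] \in E) z j)%N;
  ip_line : forall i j : V, [set i; j] \in E ->
    (f (Some i, Some j) + f (Some j, Some i)
     <= y [set i; j] + w ([set i; j], i) + w ([set i; j], j))%N;
  ip_incident : forall e i, e \in E -> i \notin e -> w (e, i) = false;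
  ip_injection : forall i : V, (\sum_(e in E) w (e, i) <= x i)%N
}.

(* Main.v *)
Require Import Defs.
From mathcomp Require Import all_boot all_order all_algebra.
From mathcomp Require Import reals.
From mathcomp Require Import zify.

Set Implicit Arguments.
Unset Strict Implicit.
Unset Printing Implicit Defensive.

(** Write n = |V|. The constraints on f and u describe a spanning tree of the
    extended graph directed towards the root None: every node of V has exactly
    one outgoing arc, and since n arcs are used in all, the root has none. If
    the arc (i, j) is used and its reverse is not, then the order constraint of
    (i, j) reads u j >= u i + 1, so that u increases along the arcs, and that
    of (j, i) reads u j <= u i + 1. The constraints on z, y and w say that
    every edge of the tree is a phasor edge, a line edge, or the edge selected
    by an injection node incident to it.

    From a feasible point (feasible_protection), let g i be the edge that w
    assigns to i, if any, and an arbitrary incident edge otherwise. Following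
    the arcs of f, along which u is bounded and increasing, leads from every
    node to None through protected edges.

    Conversely (protection_feasible), take a breadth-first tree of the
    protected graph, rooted at None, with depth function d, and put
    u i = n - d i. The delicate point is the order constraint for an edge
    outside of the tree, which asks that u i - u j <= n - 1, while a tree on
    n + 1 nodes may have depth n; and all the pairs {i, None} are constrained,
    whether protected or not. So the depth must be at most n - 1 when n > 1.
    This holds because P(z) is a union of closed neighbourhoods: in a connected
    graph with n > 1 it has at least two nodes if it has any
    (two_phasor_nodes), so two nodes have depth 1 in the breadth-first tree,
    and a tree with two nodes on its first level has depth at most n - 1
    (depth_branching). When n = 1, the only edge of the extended graph belongs
    to the tree. *)

(** * Sums of indicators *)

Lemma sum_bool_gt0P (I : finType) (P b : pred I) :
  0 < \sum_(i | P i) b i -> exists2 i, P i & b i.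
Proof.
move=> s_gt0; have [i /andP[Pi bi]|none] := pickP [pred i | P i && b i].
  by exists i.
move: s_gt0; rewrite big1 // => i Pi.
by have := none i; rewrite /= Pi /= => ->.
Qed.

Lemma sum_pred1 (I : finType) (P : pred I) (a : I) :
  P a -> \sum_(i | P i) (i == a : nat) = 1.
Proof.
move=> Pa; rewrite (bigD1 a) //= eqxx big1 ?addn0 // => i /andP[_].
by move/negbTE->.
Qed.

(** * Edges and arcs of the extended graph *)

Lemma edge_neq (V : finType) (E : {set {set V}}) (i j : V) :
  is_edge_set E -> [set i; j] \in E -> i != j.
Proof. by move=> hE /hE; rewrite cards2; case: (i != j). Qed.

Lemma lift_edges_Some (V : finType) (F : {set {set V}}) (i j : V) :
  ([set Some i; Some j] \in lift_edges F) = ([set i; j] \in F).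
Proof.
rewrite /lift_edges -[[set Some i; _]]/([set Some i] :|: [set Some j]).
rewrite -!imset_set1 -imsetU mem_imset //.
by apply: imset_inj => a b [].
Qed.

Lemma lift_edges_None (V : finType) (F : {set {set V}}) (a : option V) :
  ([set a; None] \in lift_edges F) = false.
Proof.
apply/negP => /imsetP[e _ /setP/(_ None)].
by rewrite set22 => /esym /imsetP[].
Qed.

Lemma star_Some (V : finType) (A : {set V}) (i j : V) :
  ([set Some i; Some j] \in [set [set Some k; None] | k in A]) = false.
Proof. by apply/negP => /imsetP[k _ /setP/(_ None)]; rewrite set22 !inE. Qed.

Lemma star_None (V : finType) (A : {set V}) (i : V) :
  ([set Some i; None] \in [set [set Some k; None] | k in A]) = (i \in A).
Proof.
apply/imsetP/idP => [[k kA /setP/(_ (Some i))]|iA]; last by exists i.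
by rewrite !inE eqxx /= orbF => /esym /eqP[->].
Qed.

Section ExtArcs.
Variables (V : finType) (E : {set {set V}}).

Lemma ext_arcs_Some (i j : V) :
  ((Some i, Some j) \in ext_arcs E) = ([set i; j] \in E).
Proof. by rewrite inE /= in_setU lift_edges_Some star_Some orbF. Qed.

Lemma ext_arcs_to_None (i : V) : (Some i, None) \in ext_arcs E.
Proof. by rewrite inE /= in_setU star_None inE orbT. Qed.

Lemma ext_arcs_sym (a b : option V) :
  ((a, b) \in ext_arcs E) = ((b, a) \in ext_arcs E).
Proof. by rewrite !inE /= setUC. Qed.

(** The arcs are counted by their tail. When each node of V has one outgoing
    arc, the size constraint thus says that none leaves None. *)
Lemma sum_ext_arcs (f : {ffun option V * option V -> bool}) :
  (forall i : option V, i != None ->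
     \sum_(j | (i, j) \in ext_arcs E) f (i, j) = 1) ->
  \sum_(a in ext_arcs E) f a
  = \sum_(j | (None, j) \in ext_arcs E) f (None, j) + #|V|.
Proof.
move=> out.
have -> : \sum_(a in ext_arcs E) f a =
    \sum_i \sum_(j | (i, j) \in ext_arcs E) f (i, j).
  by rewrite pair_big_dep /=; apply: eq_big => [[i j]|[i j]].
rewrite (bigD1 None) //= (eq_bigr _ (fun i h => out i h)) sum1_card.
congr (_ + _).
have -> : #|[pred i : option V | i != None]| = #|predC1 (None : option V)|.
  by apply: eq_card => i; rewrite !inE.
by rewrite cardC1 card_option.
Qed.

End ExtArcs.

(** * Breadth-first depth *)

Lemma edge_connect_sym (T : finType) (F : {set {set T}}) :
  connect_sym (fun u v => [set u; v] \in F).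
Proof. by apply: sym_connect_sym => u v; rewrite setUC. Qed.

Section Depth.
Variables (T : finType) (e : rel T) (r : T).

(** The depth of v is the least length of a walk from r to v. The node before
    v on a shortest walk is its parent; the last clause is what makes all the
    neighbours of r have depth at most 1. *)
Lemma bfs_depth : (forall v, connect e r v) ->
  exists d : T -> nat,
  [/\ d r = 0,
      forall v, v != r -> exists2 p, e p v & d v = (d p).+1
    & forall v w, e v w -> d w <= (d v).+1].
Proof.
move=> conn.
pose walk v k := [exists s : k.-tuple T, path e r s && (last r s == v)].
have walkP v s : path e r s -> last r s = v -> walk v (size s).
  by move=> ps ls; apply/existsP; exists (in_tuple s); rewrite /= ps ls eqxx.
have ex_walk v : exists k, walk v k.
  by have /connectP[s ps ls] := conn v; exists (size s); apply: walkP.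
pose d v := ex_minn (ex_walk v).
have d_min v k : walk v k -> d v <= k.
  by rewrite /d; case: ex_minnP => m _; apply.
have d_walk v : exists s, [/\ path e r s, last r s = v & size s = d v].
  rewrite /d; case: ex_minnP => m /existsP[s /andP[ps /eqP ls]] _.
  by exists s; rewrite size_tuple.
have d_step v w : e v w -> d w <= (d v).+1.
  move=> evw; have [s [ps ls <-]] := d_walk v.
  rewrite -(size_rcons s w); apply/d_min/walkP; last by rewrite last_rcons.
  by rewrite rcons_path ps ls.
exists d; split=> //.
  by apply/eqP; rewrite -leqn0; apply/d_min/(walkP _ [::]).
move=> v v_r; have [s] := d_walk v.
case/lastP: s => [|s x] [ps ls ss]; first by rewrite -ls eqxx in v_r.
move: ps ls ss; rewrite rcons_path last_rcons size_rcons => /andP[ps ex] <- ss.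
exists (last r s) => //; apply/eqP; rewrite eqn_leq d_step // -ss ltnS.
exact/d_min/walkP.
Qed.

(** If a node has depth m > 0, then each of the levels 0, ..., m is inhabited
    and level 1 has two nodes, whence at least m + 2 nodes of depth at most
    m. *)
Lemma depth_branching (d : T -> nat) (a b : T) :
  (forall v, v != r -> exists2 p, e p v & d v = (d p).+1) ->
  d r = 0 -> d a = 1 -> d b = 1 -> a != b ->
  forall v, (d v).+1 < #|T|.
Proof.
move=> parent dr da db ab v.
have r_a : r != a by apply/eqP => ra; rewrite -ra dr in da.
have r_b : r != b by apply/eqP => rb; rewrite -rb dr in db.
have level m w : d w = m.+1 -> m.+2 < #|[set t | d t <= m.+1]|.
  elim: m w => [|m IHm] w dw.
    have <- : #|[set r; a; b]| = 3.
      by rewrite setUC cardsU1 cards2 !inE r_a negb_or eq_sym r_b eq_sym ab.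
    apply/subset_leq_card/subsetP => t.
    by rewrite !inE => /orP[/orP[]|] /eqP->; rewrite ?dr ?da ?db.
  have [|p _ dp] := parent w.
    by apply: contra_eq_neq dw => ->; rewrite dr.
  have {dp} /IHm : d p = m.+1 by rewrite dw in dp; case: dp.
  move/leq_ltn_trans; apply; apply: proper_card; apply/properP; split.
    by apply/subsetP => t; rewrite !inE; apply: leqW.
  by exists w; rewrite !inE dw ?leqnn ?ltnn.
case dv: (d v) => [|m].
  by have := level 0 a da; have := max_card [set t | d t <= 1]; lia.
exact: leq_trans (level m v dv) (max_card _).
Qed.

End Depth.

(** * Protection and the integer program *)

Section Reformulation.
Variables (V : finType) (E : {set {set V}}).
Variables (x : {ffun V -> bool}) (y : {ffun {set V} -> bool})
  (z : {ffun V -> bool}).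
Hypothesis hE : is_edge_set E.

Definition protected_edges (g : V -> {set V}) :=
  lift_edges (line_edges E y) :|: phasor_edges E z
    :|: lift_edges (g @: injection_nodes x).

Lemma protected_Some g (i j : V) :
  ([set Some i; Some j] \in protected_edges g) =
  ([set i; j] \in line_edges E y) || ([set i; j] \in g @: injection_nodes x).
Proof. by rewrite !in_setU !lift_edges_Some star_Some orbF. Qed.

Lemma protected_None g (i : V) :
  ([set Some i; None] \in protected_edges g) = (i \in phasor_nodes E z).
Proof. by rewrite !in_setU !lift_edges_None star_None orbF. Qed.

Lemma phasor_sum_gt0 i : (i \in phasor_nodes E z) =
  (0 < z i + \sum_(j | [set i; j] \in E) z j).
Proof.
rewrite inE addn_gt0 lt0b; congr (_ || _); apply/existsP/idP.
  by case=> k /andP[zk ik]; rewrite (bigD1 k) //= zk.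
by case/sum_bool_gt0P => k ik zk; exists k; rewrite zk ik.
Qed.

(** A node k with z_k = 1 covers itself and all its neighbours, and it has a
    neighbour when the graph is connected and not a single node. *)
Lemma two_phasor_nodes i : connected_graph E -> i \in phasor_nodes E z ->
  1 < #|V| -> exists k l, [/\ k \in phasor_nodes E z, l \in phasor_nodes E z
                            & k != l].
Proof.
move=> [_ conn] iP V_gt1.
have [k zk] : exists k, z k.
  move: iP; rewrite inE => /orP[zi|/existsP[k /andP[zk _]]]; first by exists i.
  by exists k.
have [l lk] : exists l, l != k.
  apply/existsP; rewrite -[[exists _, _]]negbK negb_exists.
  apply/negP => /forallP all_k.
  have /subset_leq_card : [set: V] \subset [set k].
    by apply/subsetP => l _; rewrite inE -[_ == _]negbK all_k.
  by rewrite cardsT cards1 leqNgt V_gt1.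
have /connectP[[|m s] /= ps ls] := conn k l; first by rewrite ls eqxx in lk.
case/andP: ps => km _; exists k, m; split; last exact: edge_neq km.
  by rewrite inE zk.
by rewrite inE; apply/orP; right; apply/existsP; exists k; rewrite zk setUC.
Qed.

(** The parent map of a breadth-first tree gives f, the depth subtracted from
    |V| gives u, and w marks the edge g i at each injection node i. *)
Lemma protection_feasible (MI : {set V}) (ML : {set {set V}}) (MP : {set V}) :
  connected_graph E -> admissible MI ML MP x y z ->
  perfect_protection E x y z ->
  exists w f u, ip_feasible E MI ML MP x y z w f u.
Proof.
move=> hconn adm [g [gE [_ conn]]].
have gI i : x i -> g i \in E /\ i \in g i by move=> xi; apply: gE; rewrite inE.
have [d [d0 d_parent d_step]] := bfs_depth (conn None).
pose parent (i : V) := odflt None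
  [pick p | ([set p; Some i] \in protected_edges g)
            && (d (Some i) == (d p).+1)].
have parentP i : [set parent i; Some i] \in protected_edges g /\
                 d (Some i) = (d (parent i)).+1.
  rewrite /parent; case: pickP => [p /andP[? /eqP]|none] //=.
  have [//|p ep dp] := d_parent (Some i).
  by have := none p; rewrite /protected_edges ep dp eqxx.
have parent_edge i j : parent i = Some j -> [set i; j] \in E /\
    ([set i; j] \in line_edges E y \/ [set i; j] \in g @: injection_nodes x).
  move=> pij; have [] := parentP i; rewrite pij setUC protected_Some => /orP.
  case=> h _; split; [|by left| |by right].
    by move: h; rewrite inE => /andP[].
  by case/imsetP: h => k; rewrite inE => /gI[gk _] ->.
have V_gt0 : 0 < #|V| by case: hconn.
(* A node of V of least depth is a child of the root. *)
have [i0 parent_i0] : exists i0, parent i0 = None.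
  have [v _] := card_gt0P V_gt0.
  case: (arg_minnP (fun i : V => d (Some i)) (isT : xpredT v)) => i0 _ min_i0.
  exists i0; have [_] := parentP i0; case: (parent i0) => // j dj.
  by have := min_i0 j isT; rewrite dj ltnn.
have depth_lt i : 1 < #|V| -> d i < #|V|.
  move=> V_gt1.
  have [k [l [kP lP kl]]] : exists k l, [/\ k \in phasor_nodes E z,
      l \in phasor_nodes E z & k != l].
    apply: (@two_phasor_nodes i0) => //.
    by have [+ _] := parentP i0; rewrite parent_i0 setUC protected_None.
  have level1 m : m \in phasor_nodes E z -> d (Some m) = 1.
    rewrite -(protected_None g) setUC => /d_step; rewrite d0.
    by have [_ ->] := parentP m; case: (d _).
  rewrite -ltnS -card_option.
  exact: (depth_branching d_parent d0 (level1 k kP) (level1 l lP)).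
(* If |V| = 1, the parent of the only node of V has to be None. *)
have depth_le i : d i <= #|V|.
  have [V_gt1|V_le1] := ltnP 1 #|V|; first exact/ltnW/depth_lt.
  have {}V_le1 : #|V| = 1 by apply/eqP; rewrite eqn_leq V_le1.
  case: i => [i|]; last by rewrite d0.
  have [+ ->] := parentP i.
  case: (parent i) (parent_edge i) => [j /(_ j erefl)[ij _]|].
    have V_le : #|V| <= 1 by rewrite V_le1.
    by have := edge_neq hE ij; rewrite (fintype_le1P V_le i j) eqxx.
  by rewrite d0 V_le1.
pose f : {ffun option V * option V -> bool} :=
  [ffun a => if a.1 is Some i then a.2 == parent i else false].
have fS i j : f (Some i, j) = (j == parent i) by rewrite ffunE.
have fN j : f (None, j) = false by rewrite ffunE.
have f_depth i j : f (i, j) -> d i = (d j).+1.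
  case: i => [i|]; last by rewrite fN.
  by rewrite fS => /eqP ->; case: (parentP i).
have out (i : option V) : i != None ->
    \sum_(j | (i, j) \in ext_arcs E) f (i, j) = 1.
  case: i => // i _; under eq_bigr => j _ do rewrite fS.
  apply: sum_pred1; case pi: (parent i) => [j|]; last exact: ext_arcs_to_None.
  by rewrite ext_arcs_Some; case: (parent_edge i j pi).
(* For a pair joined by no arc of f, the order constraint amounts to this
   bound. If |V| = 1, a larger gap makes j a child of i. *)
have depth_gap i j : f (j, i) = false -> d j < d i + #|V|.
  have [V_gt1 _|V_le1] := ltnP 1 #|V|.
    exact: leq_trans (depth_lt j V_gt1) (leq_addl _ _).
  have V1 : #|V| = 1 by apply/eqP; rewrite eqn_leq V_le1.
  apply: contraFT; rewrite -leqNgt V1 addn1 => di_j.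
  have := depth_le j; rewrite V1 => dj1.
  case: j di_j dj1 => [j|]; last by rewrite d0.
  have [_ dj] := parentP j; rewrite fS.
  case: (parent j) dj => [k|]; first by have [_ ->] := parentP k; lia.
  by case: i => // i; have [_ ->] := parentP i; lia.
pose w : {ffun {set V} * V -> bool} :=
  [ffun ei => x ei.2 && (g ei.2 == ei.1)].
have covered i j : Some j = parent i ->
    0 < y [set i; j] + w ([set i; j], i) + w ([set i; j], j).
  move/esym/parent_edge => [_ [|/imsetP[k xk ek]]].
    by rewrite inE => /andP[_ ->].
  rewrite inE in xk.
  (* The edge {i, j} is g k, and k is one of its ends: k is i or j. *)
  have wk : w ([set i; j], k) by rewrite ffunE /= ek eqxx xk.
  have: k \in [set i; j] by rewrite ek; case: (gI k xk).
  by rewrite !inE => /orP[] /eqP k_eq; rewrite k_eq in wk; rewrite wk; lia.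
exists w, f, [ffun i => inord (#|V| - d i)].
split=> //.
(* The constraint is tight on an arc of f; depth_gap serves when neither
   direction is used. *)
- move=> i j _.
  have := @f_depth i j; have := @f_depth j i; have := @depth_gap i j.
  have := depth_le i; have := depth_le j.
  rewrite card_option !(ffunE (fun i => inord _)) !inordK ?ltnS ?leq_subr //.
  move: (f (i, j)) (f (j, i)) (d i) (d j) => [] [] di dj; lia.
- move=> i; rewrite ffunE inordK ?ltnS ?leq_subr // card_option; lia.
- by rewrite (bigD1 (Some i0)) ?ext_arcs_to_None //= fS parent_i0.
- rewrite sum_ext_arcs // big1 ?card_option ?subn1 // => j _.
  by rewrite fN.
- move=> i; rewrite fN add0n fS.
  case: eqP => //= pi; rewrite -phasor_sum_gt0 -(protected_None g) pi setUC.
  by case: (parentP i).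
- move=> i j _; rewrite !fS.
  have [pij|_] := eqVneq; have [pji|_] := eqVneq => //.
  + have [_ di] := parentP i; have [_ dj] := parentP j.
    by move: di dj; rewrite -pij -pji => ->; lia.
  + exact: covered.
  + by rewrite setUC -addnA [w _ + _]addnC addnA; apply: covered.
- move=> e i _ ie; rewrite ffunE /=; apply/negP => /andP[/gI[_ ig] /eqP ge].
  by rewrite -ge ig in ie.
- move=> i; case xi: (x i); last by rewrite big1 // => e _; rewrite ffunE /= xi.
  rewrite (eq_bigr (fun e => (e == g i : nat))).
    by rewrite sum_pred1 //; case: (gI i xi).
  by move=> e _; rewrite ffunE /= xi eq_sym.
Qed.

(** The values of u strictly increase along the arcs of f between nodes of V,
    so the walk that follows f from any node ends, which it can only do at
    None. *)
Lemma feasible_protection (MI : {set V}) (ML : {set {set V}}) (MP : {set V})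
    w f u :
  (forall i, i \in MI -> exists2 e, e \in E & i \in e) ->
  ip_feasible E MI ML MP x y z w f u -> perfect_protection E x y z.
Proof.
move=> hMI [[xMI _ _] order _ out _ size phasor line incident injection].
(* Injection nodes to which w assigns no edge still need an incident one; it
   exists because they belong to MI. *)
pose g i := odflt (odflt set0 [pick e in E | i \in e]) [pick e in E | w (e, i)].
have g_edge i : x i -> g i \in E /\ i \in g i.
  move=> xi; rewrite /g.
  case: (pickP [pred e in E | w (e, i)]) => [e /andP[eE wei]|_] /=.
    split=> //; apply/negPn/negP => ie.
    by rewrite (incident _ _ eE ie) in wei.
  have [|e eE ie] := hMI i; first by apply: contraLR xi => /xMI ->.
  case: pickP => [e' /andP[]//|none].
  by have := none e; rewrite eE ie.
(* At most one edge is assigned to i, so the chosen one is e. *)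
have g_w i e : e \in E -> w (e, i) -> x i /\ g i = e.
  move=> eE wei; have := injection i; rewrite (bigD1 e) //= wei => sum_le.
  split; first by case: (x i) sum_le.
  rewrite /g; case: (pickP [pred e in E | w (e, i)]) => /= [e'|none];
    last first.
    by have := none e; rewrite /= eE wei.
  case/andP=> e'E we'.
  apply: contraTeq sum_le => e'_e; rewrite (bigD1 e') ?e'E //= we'.
  by case: (x i).
have no_root_arc i : f (None, Some i) = false.
  have : \sum_(j | (None, j) \in ext_arcs E) f (None, j) = 0.
    by move: size; rewrite sum_ext_arcs // card_option; lia.
  move/eqP; rewrite sum_nat_eq0 => /forallP/(_ (Some i)).
  by rewrite ext_arcs_sym ext_arcs_to_None; case: (f _).
(* Adding the order constraints of both directions rules out that f takes both
   arcs, since |V| > 1; the one of (i, j) then gives the inequality. *)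
have arc_up i j : [set i; j] \in E -> f (Some i, Some j) ->
    u (Some i) < u (Some j).
  move=> ij fij.
  have V_gt1 : 1 < #|V| by rewrite -(@hE _ ij) max_card.
  have := order (Some i) (Some j); rewrite ext_arcs_Some => /(_ ij).
  have := order (Some j) (Some i); rewrite ext_arcs_Some setUC => /(_ ij).
  by rewrite fij card_option; case: (f (Some j, Some i)); lia.
have to_root k i : #|V| - u (Some i) < k ->
    connect (fun a b => [set a; b] \in protected_edges g) (Some i) None.
  elim: k i => // k IHk i; rewrite ltnS => i_k.
  have [|[j|] ij fij] := @sum_bool_gt0P _
    (fun j => (Some i, j) \in ext_arcs E) (fun j => f (Some i, j)).
  - by rewrite out.
  - rewrite ext_arcs_Some in ij.
    have uij := arc_up i j ij fij; have := ltn_ord (u (Some j)).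
    rewrite ltnS => uj.
    apply: (connect_trans _ (IHk j _)); last by lia.
    apply: connect1; rewrite protected_Some.
    have := line i j ij; rewrite fij !inE ij.
    case yij: (y _) => //=; case wi: (w (_, i)) => /=.
      have [xi <-] := g_w i _ ij wi.
      by move=> _; apply: imset_f; rewrite inE.
    case wj: (w (_, j)) => //=; have [xj <-] := g_w j _ ij wj.
    by move=> _; apply: imset_f; rewrite inE.
  - apply: connect1; rewrite protected_None phasor_sum_gt0.
    by have := phasor i; rewrite fij no_root_arc.
exists g; split; first by move=> i; rewrite inE => /g_edge.
have root_conn a : connect (fun a b => [set a; b] \in protected_edges g) a None.
  by case: a => [i|]; [apply: to_root (ltnSn _)|apply: connect0].
split; first by rewrite card_option.
move=> a b; apply: (connect_trans (root_conn a)).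
by rewrite edge_connect_sym; apply: root_conn.
Qed.

End Reformulation.

Unset Implicit Arguments.

Theorem mainTheorem4 (R : realType) (V : finType) (E : {set {set V}})
    (MI : {set V}) (ML : {set {set V}}) (MP : {set V})
    (cI : V -> R) (cL : {set V} -> R) (cP : V -> R)
    (hE : is_edge_set E) (hconn : connected_graph E)
    (hMI : forall i, i \in MI -> exists2 e, e \in E & i \in e)
    (hML : ML \subset E) :
  (forall (x : {ffun V -> bool}) (y : {ffun {set V} -> bool})
          (z : {ffun V -> bool}) (w : {ffun {set V} * V -> bool})
          (f : {ffun option V * option V -> bool})
          (u : {ffun option V -> 'I_#|V|.+1}),
      ip_objective MI ML MP cI cL cP x y z w f u
      = ppp_objective MI ML MP cI cL cP x y z) /\
  (forall (x : {ffun V -> bool}) (y : {ffun {set V} -> bool})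
          (z : {ffun V -> bool}),
      admissible MI ML MP x y z ->
      (perfect_protection E x y z <->
       exists (w : {ffun {set V} * V -> bool})
              (f : {ffun option V * option V -> bool})
              (u : {ffun option V -> 'I_#|V|.+1}),
         ip_feasible E MI ML MP x y z w f u)).
Proof.
split=> // x y z adm; split; first exact: protection_feasible.
by case=> w [f [u]]; apply: feasible_protection.
Qed.
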